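(* Let $\mathcal Q$ be a quasivariety and let $\mathbf F$ be its free algebra of countably infinite rank. The following conditions are equivalent: (1) $\mathcal Q$ is almost structurally complete; (2) for every $\mathbf A\in\mathcal Q$, $\mathbf A\times\mathbf F\in\mathsf Q(\mathbf F)$; (3) for every $\mathcal Q$-subdirectly irreducible algebra $\mathbf S$, $\mathbf S\times\mathbf F\in\mathsf Q(\mathbf F)$; (4) for every $\mathbf A\in\mathcal Q$, if there is a homomorphism from $\mathbf A$ into $\mathbf F$ then $\mathbf A\in\mathsf Q(\mathbf F)$; (5) for every $\mathcal Q$-finitely presented algebra $\mathbf P$, if there is a homomorphism from $\mathbf P$ into $\mathbf F$ then $\mathbf P\in\mathsf Q(\mathbf F)$.
   Context: A quasi-identity is a first-order sentence $q=(\forall\bar x)[\varphi(\bar x)\to\psi(\bar x)]$, where $\varphi$ is a finite (possibly empty) conjunction of equations between terms and $\psi$ is an equation; put $q^*=(\forall\bar x)\,\neg\varphi(\bar x)$. A quasivariety is a class of algebras of a fixed language defined by quasi-identities; $\mathsf Q(\mathcal K)$ denotes the quasivariety generated by a class (or algebra) $\mathcal K$. For a quasivariety $\mathcal Q$, $\mathbf F$ denotes the free algebra for $\mathcal Q$ over a countably infinite set, and $\mathbf F(k)$ the free algebra of rank $k$. A quasi-identity $q$ true in $\mathbf F$ is $\mathcal Q$-active if $q^*$ fails in $\mathbf F$. $\mathcal Q$ is almost structurally complete (ASC) if every $\mathcal Q$-active quasi-identity holds in all of $\mathcal Q$. A congruence $\alpha$ of $\mathbf A$ is a $\mathcal Q$-congruence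 if $\mathbf A/\alpha\in\mathcal Q$; a nontrivial $\mathbf S\in\mathcal Q$ is $\mathcal Q$-subdirectly irreducible if the equality relation is completely meet-irreducible in the lattice of $\mathcal Q$-congruences of $\mathbf S$. An algebra is $\mathcal Q$-finitely presented if it is isomorphic to $\mathbf F(k)/\theta$ where $k\in\mathbb N$ and $\theta$ is the least $\mathcal Q$-congruence of $\mathbf F(k)$ containing some finite set of pairs. *)

(* Defs.v *)
From mathcomp Require Import all_boot generic_quotient.
From mathcomp Require Import boolp classical_sets functions cardinality.

Set Implicit Arguments.
Unset Strict Implicit.
Unset Printing Implicit Defensive.

Local Open Scope quotient_scope.
Local Open Scope classical_set_scope.

(* No restriction is put on the number of operation symbols. *)
Record language := Language { symbol : Type; arity : symbol -> nat }.

(* As usual in universal algebra, carriers are nonempty. *)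
Record algebra (L : language) := Algebra {
  carrier :> Type;
  oper : forall f : symbol L, ('I_(arity f) -> carrier) -> carrier;
  carrier_nonempty : inhabited carrier }.
Arguments oper {L} _ f _.

Definition hom (L : language) (A B : algebra L) (h : A -> B) : Prop :=
  forall f (x : 'I_(arity f) -> A), h (oper A f x) = oper B f (h \o x).

Definition isomorphic (L : language) (A B : algebra L) : Prop :=
  exists h : A -> B, hom h /\ bijective h.

Definition nontrivial (L : language) (A : algebra L) : Prop :=
  exists x y : A, x <> y.

Definition prod_algebra (L : language) (A B : algebra L) : algebra L :=
  @Algebra L (A * B)%type
    (fun f x => (oper A f (fst \o x), oper B f (snd \o x)))
    (let: inhabits a := carrier_nonempty A in
     let: inhabits b := carrier_nonempty B in inhabits (a, b)).

Inductive term (L : language) (X : Type) : Type :=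
| Var of X
| App (f : symbol L) of ('I_(arity f) -> term L X).
Arguments Var {L X} _.
Arguments App {L X} f _.

Fixpoint eval (L : language) (X : Type) (A : algebra L) (v : X -> A)
    (t : term L X) : A :=
  match t with
  | Var x => v x
  | App f ts => oper A f (fun i => eval v (ts i))
  end.

Definition equation (L : language) := (term L nat * term L nat)%type.

Definition satisfies (L : language) (A : algebra L) (v : nat -> A)
    (e : equation L) : Prop := eval v e.1 = eval v e.2.

(* The sentence (forall x) [/\ premises -> conclusion]; carriers being nonempty,
   quantifying over valuations of all the variables x_0, x_1, ... is the same
   as quantifying over the variables that occur. *)
Record quasi_identity (L : language) := QuasiIdentity {
  premises : seq (equation L);
  conclusion : equation L }.

Definition satisfies_premises (L : language) (A : algebra L) (v : nat -> A)
    (q : quasi_identity L) : Prop :=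
  foldr (fun e P => satisfies v e /\ P) True (premises q).

Definition models (L : language) (A : algebra L) (q : quasi_identity L) : Prop :=
  forall v : nat -> A, satisfies_premises v q -> satisfies v (conclusion q).

(* A satisfies q^* *)
Definition models_star (L : language) (A : algebra L) (q : quasi_identity L)
    : Prop :=
  forall v : nat -> A, ~ satisfies_premises v q.

Definition Mod (L : language) (E : set (quasi_identity L)) : algebra L -> Prop :=
  fun A => forall q, E q -> models A q.

Definition quasivariety (L : language) (Q : algebra L -> Prop) : Prop :=
  exists E : set (quasi_identity L), forall A, Q A <-> Mod E A.

(* the least quasivariety containing the class K *)
Definition generated_quasivariety (L : language) (K : algebra L -> Prop)
    : algebra L -> Prop :=
  fun A => forall Q : algebra L -> Prop, quasivariety Q ->
    (forall B, K B -> Q B) -> Q A.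

Record congruence (L : language) (A : algebra L) := Congruence {
  con_rel :> A -> A -> Prop;
  con_refl : forall x, con_rel x x;
  con_sym : forall x y, con_rel x y -> con_rel y x;
  con_trans : forall x y z, con_rel x y -> con_rel y z -> con_rel x z;
  con_oper : forall f (x y : 'I_(arity f) -> A),
    (forall i, con_rel (x i) (y i)) -> con_rel (oper A f x) (oper A f y) }.

Section Quotient.
Context (L : language) (A : algebra L) (a : congruence A).

Definition con_bool (x y : {classic A}) : bool := `[< a x y >].

Fact con_bool_refl : reflexive con_bool.
Proof. by move=> x; apply/asboolP/con_refl. Qed.

Fact con_bool_sym : symmetric con_bool.
Proof. by move=> x y; apply/asboolP/asboolP => /con_sym. Qed.

Fact con_bool_trans : transitive con_bool.
Proof.
by move=> y x z /asboolP xy /asboolP yz; apply/asboolP/(con_trans xy yz).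
Qed.

Canonical con_equiv :=
  EquivRel con_bool con_bool_refl con_bool_sym con_bool_trans.

(* By [con_oper] the choice of representatives is immaterial, see
   [quotient_pi_hom]. *)
Definition quotient : algebra L :=
  @Algebra L {eq_quot con_equiv}
    (fun f u => \pi_{eq_quot con_equiv} (oper A f (fun i => repr (u i))))
    (let: inhabits x := carrier_nonempty A in
     inhabits (\pi_{eq_quot con_equiv} x)).

Definition quotient_pi (x : A) : quotient := \pi_{eq_quot con_equiv} x.

Lemma quotient_piP (x y : A) : quotient_pi x = quotient_pi y <-> a x y.
Proof.
split=> [/eqmodP /asboolP //|axy].
by apply/eqmodP/asboolP.
Qed.

Lemma quotient_pi_surj (u : quotient) : exists x, u = quotient_pi x.
Proof. by exists (repr (u : {eq_quot con_equiv})); rewrite /quotient_pi reprK. Qed.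

Lemma quotient_pi_hom : hom quotient_pi.
Proof.
move=> f x; apply/quotient_piP/con_oper => i.
by apply/quotient_piP; rewrite /quotient_pi /= reprK.
Qed.

End Quotient.

Definition eq_congruence (L : language) (A : algebra L) : congruence A.
Proof.
refine (@Congruence L A eq (@erefl A) (@esym A) (@etrans A) _).
by move=> f x y xy; congr (oper A f); apply: funext.
Defined.

Definition relative_congruence (L : language) (Q : algebra L -> Prop)
    (A : algebra L) : set (congruence A) :=
  [set a | Q (quotient a)].

Definition con_le (L : language) (A : algebra L) (a b : congruence A) : Prop :=
  forall x y, a x y -> b x y.

(* m is the meet of X in the lattice of Q-congruences of A *)
Definition is_meet (L : language) (Q : algebra L -> Prop) (A : algebra L)
    (X : set (congruence A)) (m : congruence A) : Prop :=
  [/\ relative_congruence Q m,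
      forall a, X a -> con_le m a
    & forall b, relative_congruence Q b -> (forall a, X a -> con_le b a) ->
      con_le b m].

Definition completely_meet_irreducible (L : language) (Q : algebra L -> Prop)
    (A : algebra L) (m : congruence A) : Prop :=
  relative_congruence Q m /\
  forall X : set (congruence A), X `<=` @relative_congruence L Q A ->
    is_meet Q X m -> X m.

Definition subdirectly_irreducible (L : language) (Q : algebra L -> Prop)
    (S : algebra L) : Prop :=
  [/\ Q S, nontrivial S & completely_meet_irreducible Q (eq_congruence S)].

Definition term_algebra (L : language) (X : Type) (ne : inhabited (term L X))
    : algebra L :=
  @Algebra L (term L X) (@App L X) ne.

(* the pairs of terms identified by every valuation in every algebra of Q *)
Definition identities (L : language) (Q : algebra L -> Prop) (X : Type)
    (ne : inhabited (term L X)) : congruence (term_algebra ne).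
Proof.
refine (@Congruence L (term_algebra ne)
  (fun s t => forall A : algebra L, Q A ->
     forall v : X -> A, eval v s = eval v t) _ _ _ _).
- by [].
- by move=> s t st A QA v; rewrite st.
- by move=> s t u st tu A QA v; rewrite st // tu.
- move=> f s t st A QA v /=; congr (oper A f).
  by apply: funext => i; apply: st.
Defined.

(* The free algebra for Q over X, see [free_in] and [free_universal].  It
   exists as soon as there is a term over X, i.e. unless X is empty and the
   language has no constant symbol. *)
Definition free (L : language) (Q : algebra L -> Prop) (X : Type)
    (ne : inhabited (term L X)) : algebra L :=
  quotient (identities Q ne).

Definition free_gen (L : language) (Q : algebra L -> Prop) (X : Type)
    (ne : inhabited (term L X)) (x : X) : free Q ne :=
  quotient_pi (identities Q ne) (Var x).

Definition free_omega (L : language) (Q : algebra L -> Prop) : algebra L :=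
  free Q (inhabits (Var 0 : term L nat)).

Definition active (L : language) (Q : algebra L -> Prop) (q : quasi_identity L)
    : Prop :=
  models (free_omega Q) q /\ ~ models_star (free_omega Q) q.

Definition almost_structurally_complete (L : language) (Q : algebra L -> Prop)
    : Prop :=
  forall q : quasi_identity L, active Q q ->
    forall A : algebra L, Q A -> models A q.

Definition least_relative_congruence (L : language) (Q : algebra L -> Prop)
    (A : algebra L) (R : set (A * A)) (a : congruence A) : Prop :=
  [/\ relative_congruence Q a,
      forall x y, R (x, y) -> a x y
    & forall b, relative_congruence Q b -> (forall x y, R (x, y) -> b x y) ->
      con_le a b].

Definition finitely_presented (L : language) (Q : algebra L -> Prop)
    (P : algebra L) : Prop :=
  exists (k : nat) (ne : inhabited (term L 'I_k))
    (R : set (free Q ne * free Q ne)) (theta : congruence (free Q ne)),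
    [/\ finite_set R, least_relative_congruence Q R theta
      & isomorphic P (quotient theta)].

Lemma hom_eval (L : language) (X : Type) (A B : algebra L) (h : A -> B)
    (v : X -> A) (t : term L X) : hom h -> h (eval v t) = eval (h \o v) t.
Proof.
move=> hh; elim: t => //= f ts IH; rewrite hh; congr (oper B f).
by apply: funext => i /=; exact: IH.
Qed.

Fixpoint subst (L : language) (X Y : Type) (s : X -> term L Y) (t : term L X)
    : term L Y :=
  match t with
  | Var x => s x
  | App f ts => App f (fun i => subst s (ts i))
  end.

Lemma eval_subst (L : language) (X Y : Type) (A : algebra L)
    (s : X -> term L Y) (v : Y -> A) (t : term L X) :
  eval v (subst s t) = eval (fun x => eval v (s x)) t.
Proof.
elim: t => //= f ts IH; congr (oper A f); apply: funext => i; exact: IH.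
Qed.

Section Free.
Context (L : language) (Q : algebra L -> Prop) (X : Type).
Context (ne : inhabited (term L X)).

Lemma eval_free (Y : Type) (s : Y -> term L X) (t : term L Y) :
  eval (fun y => quotient_pi (identities Q ne) (s y)) t
  = quotient_pi (identities Q ne) (subst s t).
Proof.
elim: t => // f ts IH.
transitivity (oper (quotient (identities Q ne)) f
    (quotient_pi (identities Q ne) \o (fun i => subst s (ts i)))).
  by congr (oper (quotient (identities Q ne)) f _); apply: funext => i; apply: IH.
exact/esym/(@quotient_pi_hom L _ (identities Q ne)).
Qed.

Lemma free_in : quasivariety Q -> Q (free Q ne).
Proof.
move=> [E QE]; apply/QE => q Eq v.
have [s ->] : exists s : nat -> term L X,
    v = (fun n => quotient_pi (identities Q ne) (s n)).
  have [s sP] := choice (fun n => quotient_pi_surj (v n)).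
  by exists s; apply: funext.
have satP e : satisfies (fun n => quotient_pi (identities Q ne) (s n)) e <->
    forall A, Q A -> forall w : X -> A,
      satisfies (fun n => eval w (s n)) e.
  rewrite /satisfies !eval_free quotient_piP /=.
  by split=> H A QA w; move: (H A QA w); rewrite !eval_subst.
move=> prem; apply/satP => A QA w.
have /QE /(_ q Eq) := QA; apply.
move: prem; rewrite /satisfies_premises.
elim: (premises q) => //= e es IH [/satP he hes]; split; [exact: he|exact: IH].
Qed.

Lemma free_universal (A : algebra L) (v : X -> A) : Q A ->
  exists! h : free Q ne -> A, hom h /\ forall x, h (free_gen Q ne x) = v x.
Proof.
move=> QA.
have key (u : free Q ne) : exists b : A,
    forall t, u = quotient_pi (identities Q ne) t -> b = eval v t.
  have [t ->] := quotient_pi_surj u; exists (eval v t) => t' /quotient_piP.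
  by apply.
have [h hP] := choice key.
have hE t : h (quotient_pi (identities Q ne) t) = eval v t by exact: hP.
exists h; split; first split.
- move=> f x.
  have [s sP] := choice (fun i => quotient_pi_surj (x i)).
  have -> : x = quotient_pi (identities Q ne) \o s by apply: funext.
  rewrite -[oper _ f _](@quotient_pi_hom L _ (identities Q ne) f s) hE /=.
  by congr (oper A f); apply: funext => i /=; rewrite hE.
- by move=> x; rewrite /free_gen hE.
move=> g [gh gv]; apply: funext => u; have [t ->] := quotient_pi_surj u.
rewrite hE; elim: t => /= [x|f ts IH]; first by rewrite -gv.
have -> := @quotient_pi_hom L _ (identities Q ne) f ts.
rewrite gh; congr (oper A f); apply: funext => i /=; exact/esym.
Qed.

End Free.

(* Main.v *)
Require Import Defs.
From mathcomp Require Import all_boot boolp classical_sets.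
From mathcomp Require Import cardinality.

(** The key point is that a quasivariety contains every algebra whose points
    are separated by homomorphisms into its members. The implication from (3)
    to (4) then comes from the relative form of Birkhoff's subdirect
    representation theorem: relative congruences are closed under unions of
    chains, because operations are finitary and quasi-identities have finitely
    many premises, so by Zorn's lemma distinct points of A are separated by a
    Q-subdirectly irreducible quotient S; pairing with a homomorphism A -> F
    maps A into S * F. From (5) to (1), an active quasi-identity q yields the
    algebra P finitely presented by the premises of q: P maps into F because
    the premises are solvable there, so q holds in P, and in particular at its
    generators; this is universal among solutions of the premises in Q. *)

Set Implicit Arguments.
Unset Strict Implicit.
Unset Printing Implicit Defensive.

Local Open Scope classical_set_scope.

(** * Valuations, homomorphisms, quotients and generated quasivarieties *)

Lemma foldr_andP (T : Type) (P : T -> Prop) (s : seq T) :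
  foldr (fun x R => P x /\ R) True s <->
  forall i : 'I_(size s), P (tnth (in_tuple s) i).
Proof.
elim: s => /= [|x s IH]; first by split=> // _ [].
split=> [[Px /IH Ps] i|Ps].
  case: (unliftP ord0 i) => [j|] ->; last exact: Px.
  by have := Ps j; rewrite !(tnth_nth x).
split; first exact: (Ps ord0).
by apply/IH => i; have := Ps (lift ord0 i); rewrite !(tnth_nth x).
Qed.

(** Indexing by an ordinal type lets the premises be fed to [chain_finite] and to [choice], and
    makes the range of a family over them finite. *)
Definition premise (L : language) (q : quasi_identity L)
    (i : 'I_(size (premises q))) : equation L :=
  tnth (in_tuple (premises q)) i.

Lemma satisfies_premisesP (L : language) (A : algebra L) (v : nat -> A)
    (q : quasi_identity L) :
  satisfies_premises v q <-> forall i, satisfies v (@premise L q i).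
Proof. exact: foldr_andP. Qed.

Lemma hom_comp (L : language) (A B C : algebra L) (g : B -> C) (h : A -> B) :
  hom g -> hom h -> hom (g \o h).
Proof. by move=> hg hh f x; rewrite /= hh hg. Qed.

Lemma hom_pair (L : language) (A B C : algebra L) (g : A -> B) (h : A -> C) :
  hom g -> hom h -> hom (fun x => (g x, h x) : prod_algebra B C).
Proof. by move=> hg hh f x; rewrite hg hh. Qed.

Lemma hom_satisfies (L : language) (A B : algebra L) (h : A -> B)
    (v : nat -> A) (e : equation L) :
  hom h -> satisfies v e -> satisfies (h \o v) e.
Proof. by rewrite /satisfies => hh ve; rewrite -!hom_eval // ve. Qed.

Lemma hom_satisfies_premises (L : language) (A B : algebra L) (h : A -> B)
    (v : nat -> A) (q : quasi_identity L) :
  hom h -> satisfies_premises v q -> satisfies_premises (h \o v) q.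
Proof.
move=> hh /satisfies_premisesP vq; apply/satisfies_premisesP => i.
exact: hom_satisfies.
Qed.

Lemma satisfies_pair (L : language) (A B : algebra L)
    (v : nat -> prod_algebra A B) (e : equation L) :
  satisfies (fst \o v) e -> satisfies (snd \o v) e -> satisfies v e.
Proof.
rewrite /satisfies => v1 v2.
rewrite [LHS]surjective_pairing [RHS]surjective_pairing.
by congr pair; [rewrite !(@hom_eval _ _ _ A) | rewrite !(@hom_eval _ _ _ B)].
Qed.

Lemma quotient_lift (L : language) (A B : algebra L) (a : congruence A)
    (h : A -> B) :
  hom h -> (forall x y, a x y -> h x = h y) ->
  exists g : quotient a -> B, hom g /\ forall x, g (quotient_pi a x) = h x.
Proof.
move=> hh ah; have [s sP] := choice (@quotient_pi_surj _ _ a).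
have gP x : h (s (quotient_pi a x)) = h x.
  by apply: ah; apply/quotient_piP; rewrite -sP.
exists (h \o s); split=> // f u.
have -> : u = quotient_pi a \o (s \o u) by apply: funext => i; rewrite /= -sP.
rewrite -(@quotient_pi_hom _ _ a f) /= gP hh; congr (oper B f).
by apply: funext => i /=; rewrite gP.
Qed.

Lemma quotient_valuation (L : language) (A : algebra L) (a : congruence A)
    (v : nat -> quotient a) : exists w, v = quotient_pi a \o w.
Proof.
have [w wP] := choice (fun n => quotient_pi_surj (v n)).
by exists w; apply: funext.
Qed.

Lemma satisfies_quotient (L : language) (A : algebra L) (a : congruence A)
    (v : nat -> A) (e : equation L) :
  satisfies (quotient_pi a \o v) e <-> a (eval v e.1) (eval v e.2).
Proof.
by rewrite -quotient_piP /satisfies -!hom_eval //; exact: quotient_pi_hom.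
Qed.

(** The class on the right is a quasivariety containing [K]; conversely, the axioms of any
    quasivariety containing [K] are among the quasi-identities true in [K]. *)
Lemma generated_quasivarietyP (L : language) (K : algebra L -> Prop)
    (A : algebra L) :
  generated_quasivariety K A <->
  Mod [set q | forall B, K B -> models B q] A.
Proof.
split=> [KA|AE Q [E QE] KQ].
  apply: KA => [|B KB q]; last by apply.
  by exists [set q | forall B, K B -> models B q].
by apply/QE => q Eq; apply: AE => B /KQ /QE; apply.
Qed.

Lemma quasivariety_generated (L : language) (K : algebra L -> Prop) :
  quasivariety (generated_quasivariety K).
Proof. by eexists => A; exact: generated_quasivarietyP. Qed.

(** * Kernels, meets and unions of chains of congruences *)

Definition kernel (L : language) (A B : algebra L) (h : A -> B) (hh : hom h) :
  congruence A.
Proof.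
refine (@Congruence L A (fun x y => h x = h y) _ _ _ _).
- by [].
- by [].
- by move=> x y z -> ->.
- move=> f x y xy; rewrite !hh; congr (oper B f).
  by apply: funext => i; exact: xy.
Defined.

Definition con_inf (L : language) (A : algebra L) (X : set (congruence A)) :
  congruence A.
Proof.
refine (@Congruence L A (fun x y => forall a, X a -> a x y) _ _ _ _).
- by move=> x a _; exact: con_refl.
- by move=> x y xy a Xa; exact: con_sym (xy a Xa).
- by move=> x y z xy yz a Xa; apply: con_trans (xy a Xa) (yz a Xa).
- by move=> f x y xy a Xa; apply: con_oper => i; exact: xy.
Defined.

(** Complete meet-irreducibility asks for membership in a set of congruences, so equality of the
    records themselves is required. *)
Lemma congruence_ext (L : language) (A : algebra L) (a b : congruence A) :
  con_le a b -> con_le b a -> a = b.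
Proof.
case: a b => [a ar asym at_ ao] [b br bs bt bo] ab ba.
have E : a = b.
  apply: funext => x; apply: funext => y.
  by apply: propext; split; [exact: ab|exact: ba].
clear ab ba; subst b; congr Congruence; exact: Prop_irrelevance.
Qed.

Section Chain.
Context (L : language) (A : algebra L) (C : set (congruence A)).
Hypotheses (C0 : C !=set0) (Ctot : total_on C (@con_le L A)).

Let sup x y := exists2 a, C a & a x y.

(** Induction on [n], keeping the larger of two chain members. It serves both the finitely many
    arguments of an operation and the finitely many premises of a quasi-identity. *)
Lemma chain_finite n (x y : 'I_n -> A) :
  (forall i, sup (x i) (y i)) -> exists2 a, C a & forall i, a (x i) (y i).
Proof.
elim: n x y => [|n IH] x y xy; first by have [a Ca] := C0; exists a => // -[].
have [a Ca aP] := IH _ _ (fun i => xy (lift ord0 i)).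
have [b Cb b0] := xy ord0.
have [ab|ba] := Ctot Ca Cb.
  by exists b => // i; case: (unliftP ord0 i) => [j|] -> //; exact/ab/aP.
by exists a => // i; case: (unliftP ord0 i) => [j|] -> //; exact: ba.
Qed.

Definition con_sup : congruence A.
Proof.
refine (@Congruence L A sup _ _ _ _).
- by have [a Ca] := C0 => x; exists a => //; exact: con_refl.
- by move=> x y [a Ca axy]; exists a => //; exact: con_sym.
- move=> x y z [a Ca axy] [b Cb byz].
  have [ab|ba] := Ctot Ca Cb.
    by exists b => //; apply: con_trans byz; exact: ab.
  by exists a => //; apply: con_trans axy _; exact: ba.
- by move=> f x y /chain_finite[a Ca aP]; exists a => //; exact: con_oper.
Defined.

End Chain.

(** * Relative congruences and subdirect representation *)

Section Quasivariety.
Context (L : language) (Q : algebra L -> Prop) (hQ : quasivariety Q).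

(** If a conclusion failed at [v], some [h] would separate its two sides; but [h \o v] satisfies the
    premises in [B], hence also the conclusion. *)
Lemma quasivariety_separated (A : algebra L) :
  (forall x y : A, x <> y ->
    exists (B : algebra L) (h : A -> B), [/\ Q B, hom h & h x <> h y]) ->
  Q A.
Proof.
have [E QE] := hQ => sep; apply/QE => q Eq v vq.
apply: contrapT => /sep [B [h [/QE QB hh]]]; apply.
by rewrite !hom_eval //; apply: QB => //; exact: hom_satisfies_premises.
Qed.

Lemma relative_con_inf (A : algebra L) (X : set (congruence A)) :
  X `<=` @relative_congruence L Q A -> relative_congruence Q (con_inf X).
Proof.
move=> XQ; apply: quasivariety_separated => u v.
have [[x ->] [y ->]] := (quotient_pi_surj u, quotient_pi_surj v).
move=> /quotient_piP /existsNP[a /not_implyP[Xa naxy]].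
have [|g [hg gP]] :=
  @quotient_lift _ _ _ (con_inf X) _ (@quotient_pi_hom _ _ a).
  by move=> x' y' /(_ a Xa) /quotient_piP.
exists (quotient a), g; split=> //; first exact: XQ.
by rewrite !gP => /quotient_piP.
Qed.

Lemma relative_kernel (A B : algebra L) (h : A -> B) (hh : hom h) :
  Q B -> relative_congruence Q (kernel hh).
Proof.
move=> QB; apply: quasivariety_separated => u v.
have [[x ->] [y ->]] := (quotient_pi_surj u, quotient_pi_surj v).
move=> /quotient_piP nxy.
have [//|g [hg gP]] := @quotient_lift _ _ _ (kernel hh) _ hh.
by exists B, g; split=> //; rewrite !gP.
Qed.

(** All premises already hold modulo a single member of the chain, whose quotient then yields the
    conclusion. *)
Lemma relative_con_sup (A : algebra L) (C : set (congruence A))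
    (C0 : C !=set0) (Ctot : total_on C (@con_le L A)) :
  C `<=` @relative_congruence L Q A ->
  relative_congruence Q (con_sup C0 Ctot).
Proof.
have [E QE] := hQ => CQ; apply/QE => q Eq v.
have [w ->] := quotient_valuation v => /satisfies_premisesP vq.
have [|a Ca aP] := @chain_finite _ _ _ C0 Ctot _
    (fun i => eval w (@premise L q i).1) (fun i => eval w (@premise L q i).2).
  by move=> i; have /satisfies_quotient := vq i.
apply/satisfies_quotient; exists a => //; apply/satisfies_quotient.
have /QE /(_ q Eq) := CQ _ Ca; apply.
by apply/satisfies_premisesP => i; apply/satisfies_quotient.
Qed.

Lemma exists_maximal_relative_congruence (A : algebra L) (x y : A) :
  Q A -> x <> y ->
  exists m : congruence A, [/\ relative_congruence Q m, ~ m x y &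
    forall b, relative_congruence Q b -> con_le m b -> ~ b x y -> con_le b m].
Proof.
move=> QA nxy.
pose T := {a : congruence A | relative_congruence Q a /\ ~ a x y}.
have t0 : T.
  have hid : hom (@id A) by [].
  by exists (kernel hid); split=> //; exact: relative_kernel.
pose R (s t : T) := `[< con_le (sval s) (sval t) >].
have [|b a c|D Dtot|[m [Qm nm]] mmax] := @ZL_preorder T t0 R.
- by move=> a; apply/asboolP.
- by move=> /asboolP ab /asboolP bc; apply/asboolP => u v /ab /bc.
(* [con_sup] needs a nonempty chain; the empty one is bounded by [t0], the equality relation. *)
- have [->|D0] := eqVneq D set0; first by exists t0.
  have C0 : (@sval _ _ @` D) !=set0 by exact/image_nonempty/set0P.
  have Ctot : total_on (@sval _ _ @` D) (@con_le L A).
    move=> _ _ [s Ds <-] [t Dt <-].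
    by have [/asboolP|/asboolP] := Dtot s t Ds Dt; [left|right].
  have Qsup : relative_congruence Q (con_sup C0 Ctot).
    by apply: relative_con_sup => _ [[a [Qa ?]] _ <-].
  have nsup : ~ con_sup C0 Ctot x y by move=> [_ [[a [? na]] _ <-]].
  exists (exist _ (con_sup C0 Ctot) (conj Qsup nsup)) => s Ds.
  apply/asboolP => u v uv.
  by exists (sval s) => //; exists s.
exists m; split=> // b Qb mb nb.
apply/asboolP/(mmax (exist _ b (conj Qb nb))).
exact/asboolP.
Qed.

Lemma subdirectly_irreducible_separation (A : algebra L) (x y : A) :
  Q A -> x <> y ->
  exists (S : algebra L) (h : A -> S),
    [/\ subdirectly_irreducible Q S, hom h & h x <> h y].
Proof.
move=> QA /(exists_maximal_relative_congruence QA)[m [Qm nm mmax]].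
have hpi := @quotient_pi_hom _ _ m.
have nxy : quotient_pi m x <> quotient_pi m y by move/quotient_piP.
exists (quotient m), (quotient_pi m); split=> //; split=> //.
  by exists (quotient_pi m x), (quotient_pi m y).
split.
  have hid : hom (@id (quotient m)) by [].
  have -> : eq_congruence (quotient m) = kernel hid by exact: congruence_ext.
  exact: relative_kernel.
(* If equality is not in [X], every member of [X] identifies the images of [x] and [y]; so does
   [con_inf X], which lies below the meet, that is, below equality. *)
move=> X XQ [_ _ glb]; apply: contrapT => nX; apply: nxy.
apply: (glb _ (relative_con_inf XQ)) => [a Xa u v|a Xa]; first exact.
apply: contrapT => na; apply: nX.
suff -> : eq_congruence (quotient m) = a by [].
apply: congruence_ext => [u _ <-|u v]; first exact: con_refl.
have [[x' ->] [y' ->]] := (quotient_pi_surj u, quotient_pi_surj v) => auv.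
(* The kernel of this composite is the pullback of [a] to [A]: it lies above [m] and omits the pair
   [x], [y], so maximality forces it down to [m]. *)
have hh := hom_comp (@quotient_pi_hom _ _ a) hpi.
apply/quotient_piP; apply: (mmax (kernel hh)) => //=.
- by apply: relative_kernel; exact: XQ.
- by move=> z t /quotient_piP /= ->.
- by move=> axy; apply: na; apply/(quotient_piP a).
- exact/(quotient_piP a).
Qed.

Lemma finitely_presented_in (P : algebra L) : finitely_presented Q P -> Q P.
Proof.
move=> [k [ne [R [theta [_ [Qt _ _] [h [hh /bij_inj inj_h]]]]]]].
apply: quasivariety_separated => x y nxy.
by exists (quotient theta), h; split=> // /inj_h.
Qed.

End Quasivariety.

(** * The algebra presented by the premises of a quasi-identity *)

Definition agree_below (T : Type) (k : nat) (v w : nat -> T) :=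
  forall n, n < k -> v n = w n.

(** Arities are finite, so the bounds of the arguments have a maximum. This passes from valuations
    of countably many variables to free algebras of finite rank. *)
Lemma term_variables_bounded (L : language) (t : term L nat) :
  exists k, forall (A : algebra L) (v w : nat -> A),
    agree_below k v w -> eval v t = eval w t.
Proof.
elim: t => [n|f ts IH]; first by exists n.+1 => A v w; apply.
have [k kP] := choice IH; exists (\max_i k i) => A v w vw /=.
congr (oper A f); apply: funext => i; apply: kP => n nk; apply: vw.
exact: leq_trans nk (leq_bigmax i).
Qed.

Lemma equation_variables_bounded (L : language) (e : equation L) :
  exists k, forall (A : algebra L) (v w : nat -> A),
    agree_below k v w -> satisfies v e -> satisfies w e.
Proof.
have [k1 k1P] := term_variables_bounded e.1.
have [k2 k2P] := term_variables_bounded e.2.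
exists (maxn k1 k2) => A v w vw; rewrite /satisfies.
rewrite (k1P _ v w) 1?(k2P _ v w) // => n nk; apply: vw.
  exact: leq_trans nk (leq_maxr _ _).
exact: leq_trans nk (leq_maxl _ _).
Qed.

Lemma quasi_identity_variables_bounded (L : language) (q : quasi_identity L) :
  exists k, forall (A : algebra L) (v w : nat -> A), agree_below k v w ->
    (satisfies_premises v q -> satisfies_premises w q) /\
    (satisfies v (conclusion q) -> satisfies w (conclusion q)).
Proof.
have [k kP] := choice (fun i => equation_variables_bounded (@premise _ q i)).
have [l lP] := equation_variables_bounded (conclusion q).
exists (maxn l (\max_i k i)) => A v w vw; split.
  move=> /satisfies_premisesP vq; apply/satisfies_premisesP => i.
  apply: kP (vq i) => n nk; apply: vw.
  by apply: leq_trans nk _; rewrite leq_max leq_bigmax orbT.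
by apply: lP => n nl; apply: vw; rewrite leq_max nl.
Qed.

(* P is presented by the premises of q, and c is its tuple of generators. *)
Lemma universal_solution (L : language) (Q : algebra L -> Prop)
    (hQ : quasivariety Q) (q : quasi_identity L) :
  exists (P : algebra L) (c : nat -> P),
    [/\ finitely_presented Q P, satisfies_premises c q &
      forall (B : algebra L) (w : nat -> B), Q B -> satisfies_premises w q ->
        exists g : P -> B,
          hom g /\ (satisfies c (conclusion q) -> satisfies w (conclusion q))].
Proof.
have [k kP] := quasi_identity_variables_bounded q.
(* Rank [k.+1] provides a variable even when [k] is 0 and there are no constants. Out of range,
   [inord] defaults to [ord0], harmlessly, as only indices below [k] matter. *)
pose ne : inhabited (term L 'I_k.+1) := inhabits (Var ord0).
pose x n := free_gen Q ne (inord n).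
pose r (i : 'I_(size (premises q))) :=
  (eval x (premise i).1, eval x (premise i).2).
pose X := [set a : congruence (free Q ne) |
  relative_congruence Q a /\ forall i, a (r i).1 (r i).2].
pose theta := con_inf X.
have hpi := @quotient_pi_hom _ _ theta.
exists (quotient theta), (quotient_pi theta \o x); split.
- exists k.+1, ne, (range r), theta; split.
  + exact: finite_image.
  + split; first by apply: (relative_con_inf hQ) => a [].
      by move=> _ _ [i _ [<- <-]] a [_]; apply.
    by move=> b Qb bR u v; apply; split=> // i; apply: bR; exists i.
  + by exists id; split=> //; exists id.
- apply/satisfies_premisesP => i; apply/satisfies_quotient => a [_].
  exact.
- move=> B w QB wq.
  have [h [[hh hx] _]] := free_universal ne (fun i : 'I_k.+1 => w i) QB.
  have hw : agree_below k w (h \o x).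
    by move=> n nk; rewrite /= hx inordK // ltnS ltnW.
  have wh : agree_below k (h \o x) w by move=> n /hw.
  (* Membership in [X] puts [theta] below the kernel of [h], so [h] factors through the quotient. *)
  have Xh : X (kernel hh).
    split=> [|i]; first exact: relative_kernel.
    have /satisfies_premisesP /(_ i) := (kP _ _ _ hw).1 wq.
    by rewrite /satisfies -!hom_eval.
  have [|g [hg gP]] := @quotient_lift _ _ _ theta _ hh.
    by move=> u v /(_ _ Xh).
  (* [g] is only known to send the generators to [w] below [k]; hence the conclusion of [q] is
     transported instead of claiming that [g \o c] equals [w]. *)
  exists g; split=> // cq; apply: (kP _ _ _ wh).2.
  have := hom_satisfies hg cq.
  by congr satisfies; apply: funext => n /=; rewrite gP.
Qed.

Theorem theorem3p1 (L : language) (Q : algebra L -> Prop) (hQ : quasivariety Q) :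
  [<-> almost_structurally_complete Q;
       forall A : algebra L, Q A ->
         generated_quasivariety (eq (free_omega Q))
           (prod_algebra A (free_omega Q));
       forall S : algebra L, subdirectly_irreducible Q S ->
         generated_quasivariety (eq (free_omega Q))
           (prod_algebra S (free_omega Q));
       forall A : algebra L, Q A ->
         (exists h : A -> free_omega Q, hom h) ->
         generated_quasivariety (eq (free_omega Q)) A;
       forall P : algebra L, finitely_presented Q P ->
         (exists h : P -> free_omega Q, hom h) ->
         generated_quasivariety (eq (free_omega Q)) P].
Proof.
tfae.
- move=> asc A QA; apply/generated_quasivarietyP => q /(_ _ erefl) Fq v vq.
  have vq1 : satisfies_premises (fst \o v) q.
    exact: hom_satisfies_premises vq.
  have vq2 : satisfies_premises (snd \o v) q.
    exact: hom_satisfies_premises vq.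
  apply: satisfies_pair; last exact: Fq.
  (* The second coordinate solves the premises in the free algebra, so [q] is active and therefore
     holds in [A]. *)
  by apply: asc => //; split=> // /(_ _ vq2).
- by move=> prodF S [QS _ _]; exact: prodF.
- move=> siF A QA [h hh].
  (* Separation is used here for the quasivariety generated by the free algebra, not for [Q]. *)
  apply: quasivariety_separated (quasivariety_generated _) _ _ => x y nxy.
  have [S [g [siS hg gxy]]] := subdirectly_irreducible_separation hQ QA nxy.
  exists (prod_algebra S (free_omega Q)), (fun z => (g z, h z)).
  by split; [exact: siF|exact: hom_pair|case].
- by move=> homF P /(finitely_presented_in hQ); exact: homF.
- move=> fpF q [Fq /existsNP[v0 /contrapT v0q]] A QA v vq.
  have [P [c [fpP cq univ]]] := universal_solution hQ q.
  have [h [hh _]] := univ _ _ (free_in _ hQ) v0q.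
  have [g [_]] := univ _ _ QA vq; apply.
  have /generated_quasivarietyP PF := fpF _ fpP (ex_intro _ h hh).
  by apply: PF => // _ <-.
Qed.
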